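(* Let $I\subset\mathbb{R}$ be an interval, let $(\gamma,\boldsymbol{\nu}):I\to\mathbb{R}_1^2\times\Delta$ be a non-lightlike Legendre curve with $\gamma(u)=(x_1(u),x_2(u))$, $\boldsymbol{\nu}(u)=(a(u),b(u))$, let $\delta=a^2(u)-b^2(u)$, and let $\lambda\neq 0$ be a real constant. If $\delta=1$, then the 2-type helicoidal surface $$\boldsymbol{r}_2:I\times\mathbb{R}\to\mathbb{R}_1^3,\qquad \boldsymbol{r}_2(u,v)=(x_1(u)\cosh v,\ x_1(u)\sinh v,\ x_2(u)+\lambda v)$$ is a lightcone framed base surface.
   Context: All maps are of class $C^\infty$. $\mathbb{R}_1^3$ is $\mathbb{R}^3$ with the pseudo inner product $\langle \boldsymbol{x},\boldsymbol{y}\rangle=-x_1y_1+x_2y_2+x_3y_3$, and $\mathbb{R}_1^2$ is $\mathbb{R}^2$ with $\langle \boldsymbol{x},\boldsymbol{y}\rangle=-x_1y_1+x_2y_2$. The pseudo wedge product on $\mathbb{R}_1^3$ is $\boldsymbol{x}\wedge\boldsymbol{y}=\big(-(x_2y_3-x_3y_2),\ -(x_1y_3-x_3y_1),\ x_1y_2-x_2y_1\big)$. Put $\Delta=\{\boldsymbol{x}\in\mathbb{R}_1^2:\langle\boldsymbol{x},\boldsymbol{x}\rangle=1\}\cup\{\boldsymbol{x}\in\mathbb{R}_1^2:\langle\boldsymbol{x},\boldsymbol{x}\rangle=-1\}$. A smooth map $(\gamma,\boldsymbol{\nu}):I\to\mathbb{R}_1^2\times\Delta$ is a non-lightlike Legendre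 curve if $\langle\gamma'(u),\boldsymbol{\nu}(u)\rangle=0$ for all $u\in I$; the number $\delta=a^2(u)-b^2(u)\in\{1,-1\}$ is constant on $I$. Let $LC^*$ be the set of non-zero vectors $\boldsymbol{x}\in\mathbb{R}_1^3$ with $\langle\boldsymbol{x},\boldsymbol{x}\rangle=0$ and $\Delta_4=\{(\boldsymbol{v},\boldsymbol{w})\in LC^*\times LC^*:\langle\boldsymbol{v},\boldsymbol{w}\rangle=-2\}$. For a domain $U$ of the $(u,v)$-plane, a smooth map $\boldsymbol{x}:U\to\mathbb{R}_1^3$ is a lightcone framed base surface if there exist a smooth map $(\ell^+,\ell^-):U\to\Delta_4$ and smooth functions $\alpha_1,\alpha_2:U\to\mathbb{R}$ such that $\boldsymbol{x}_u\wedge\boldsymbol{x}_v=\alpha_1\ell^++\alpha_2\ell^-$ on $U$. *)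

(* Defs.v *)
From HB Require Import structures.
From mathcomp Require Import all_boot all_order all_algebra.
From mathcomp Require Import all_classical all_reals all_analysis.

Set Implicit Arguments.
Unset Strict Implicit.
Unset Printing Implicit Defensive.

Import Order.TTheory GRing.Theory Num.Theory.
Import numFieldNormedType.Exports.

Local Open Scope classical_set_scope.
Local Open Scope ring_scope.

Fixpoint Ck (R : realType) (V W : normedModType R) (k : nat)
    (O : set V) (f : V -> W) : Prop :=
  match k with
  | 0 => forall x, O x -> {for x, continuous f}
  | k'.+1 => (forall x, O x -> differentiable f x) /\
             (forall v, Ck k' O ('D_v f))
  end.

(* The set A need not be open, since an interval may contain its end points:
   f is smooth on A if near each point of A it extends to a smooth map on an
   open set.  On an open set A this is the usual notion. *)
Definition smooth_on (R : realType) (V W : normedModType R)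
    (A : set V) (f : V -> W) : Prop :=
  forall x, A x -> exists (O : set V) (g : V -> W),
    [/\ open O, O x, (forall k, Ck k O g) & {in O `&` A, f =1 g}].

(* Derivative of f at x along v, computed only with the points of A; it is
   'D_v f x when A is a neighbourhood of x, and a one-sided derivative at an
   end point of an interval. *)
Definition derive_in (R : realType) (V W : normedModType R)
    (A : set V) (f : V -> W) (v x : V) : W :=
  lim (h^-1 *: (f (h *: v + x) - f x)
        @[h --> within [set h : R | A (h *: v + x)] 0^']).

Section MinkowskiSpace.
Variable R : realType.

Definition row2 (x1 x2 : R) : 'rV[R]_2 := \row_i [:: x1; x2]`_i.
Definition row3 (x1 x2 x3 : R) : 'rV[R]_3 := \row_i [:: x1; x2; x3]`_i.

Definition pinner2 (x y : 'rV[R]_2) : R := - (x 0 0 * y 0 0) + x 0 1 * y 0 1.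

Definition pinner3 (x y : 'rV[R]_3) : R :=
  - (x 0 0 * y 0 0) + x 0 1 * y 0 1 + x 0 2 * y 0 2.

Definition pwedge (x y : 'rV[R]_3) : 'rV[R]_3 :=
  row3 (- (x 0 1 * y 0 2 - x 0 2 * y 0 1))
       (- (x 0 0 * y 0 2 - x 0 2 * y 0 0))
       (x 0 0 * y 0 1 - x 0 1 * y 0 0).

Definition Delta : set 'rV[R]_2 :=
  [set x | pinner2 x x = 1] `|` [set x | pinner2 x x = -1].

Definition LCstar : set 'rV[R]_3 := [set x | x != 0 /\ pinner3 x x = 0].

Definition Delta4 : set ('rV[R]_3 * 'rV[R]_3) :=
  [set p | [/\ LCstar p.1, LCstar p.2 & pinner3 p.1 p.2 = - 2]].

Definition nonlightlike_Legendre_curve (I : set R)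
    (gamma nu : R -> 'rV[R]_2) : Prop :=
  [/\ smooth_on I gamma, smooth_on I nu,
      forall u, I u -> Delta (nu u) &
      forall u, I u -> pinner2 (derive_in I gamma 1 u) (nu u) = 0].

Definition partial_u (U : set (R * R)) (x : R * R -> 'rV[R]_3) :
  R * R -> 'rV[R]_3 := derive_in U x (1, 0).
Definition partial_v (U : set (R * R)) (x : R * R -> 'rV[R]_3) :
  R * R -> 'rV[R]_3 := derive_in U x (0, 1).

Definition lightcone_framed_base_surface (U : set (R * R))
    (x : R * R -> 'rV[R]_3) : Prop :=
  smooth_on U x /\
  exists (ellp ellm : R * R -> 'rV[R]_3) (alpha1 alpha2 : R * R -> R),
    [/\ smooth_on U ellp /\ smooth_on U ellm,
        forall p, U p -> Delta4 (ellp p, ellm p),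
        smooth_on U alpha1 /\ smooth_on U alpha2 &
        forall p, U p -> pwedge (partial_u U x p) (partial_v U x p) =
                         alpha1 p *: ellp p + alpha2 p *: ellm p].

Definition cosh (t : R) : R := (expR t + expR (- t)) / 2.
Definition sinh (t : R) : R := (expR t - expR (- t)) / 2.

Definition helicoidal2 (gamma : R -> 'rV[R]_2) (lambda : R) (p : R * R) :
    'rV[R]_3 :=
  row3 (gamma p.1 0 0 * cosh p.2) (gamma p.1 0 0 * sinh p.2)
       (gamma p.1 0 1 + lambda * p.2).

End MinkowskiSpace.

(* Main.v *)
From HB Require Import structures.
Require Import Defs.
From mathcomp Require Import all_boot all_order all_algebra.
From mathcomp Require Import all_classical all_reals all_analysis.
From mathcomp Require Import ring lra.

Import Order.TTheory GRing.Theory Num.Theory.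
Import numFieldNormedType.Exports.

Local Open Scope classical_set_scope.
Local Open Scope ring_scope.

(** Write ch, sh for cosh v, sinh v, and put nu = (a, b), so that
    a^2 - b^2 = 1.  The Legendre condition - x1' a + x2' b = 0 says that gamma'
    is a multiple of (b, a), namely gamma' = beta (b, a) with
    beta = a x2' - b x1'.  Substituting this into r_u /\ r_v gives
      r_u /\ r_v = beta (x1 n - lambda b t),
      n = (a ch, a sh, b),   t = (sh, ch, 0).
    Here n and t are orthogonal with <n, n> = -1 and <t, t> = 1, so n + t and
    n - t are lightlike with product -2, and they span the same plane as n
    and t: the framing is ell+ = n + t, ell- = n - t with coefficients
      alpha1 = beta (x1 - lambda b) / 2,   alpha2 = beta (x1 + lambda b) / 2.
    Since beta is defined from gamma' without any division, it is smooth even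
    where gamma is singular, which is the point of using a Legendre curve.

    The rest is calculus on I x R, where I may contain its end points, so that
    smoothness means local extendability and derivatives at an end point are
    one-sided.  [Ck_linear], [Ck_comp_linear], [CkD] and [CkM] give the closure
    properties of smooth maps.  By [derive_in_ext], a derivative taken inside
    a set agrees with the derivative of any smooth extension, provided that
    the set has points arbitrarily close in the direction considered;
    [interval_limit_point] supplies this for a nondegenerate interval.  So
    gamma' is smooth on I ([smooth_on_derive_in]), and the partial derivatives
    of the surface can be computed on an extension ([partials_helicoidal2]). *)

Set Implicit Arguments.
Unset Strict Implicit.
Unset Printing Implicit Defensive.

(** * Directional derivatives, composition with linear maps, extensions *)

Section DirectionalDerivative.
Context {R : realType} {V W : normedModType R}.

Lemma is_derive_linear_comp {X : normedModType R} (L : W -> X) (f : V -> W)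
    (x v : V) (df : W) : linear L -> continuous L ->
  is_derive x v f df -> is_derive x v (L \o f) (L df).
Proof.
move=> Llin Lcont [fxv <-].
pose L' : {linear W -> X} := HB.pack L (GRing.isLinear.Build _ _ _ _ L Llin).
have cvL : h^-1 *: ((L \o f) (h *: v + x) - (L \o f) x) @[h --> 0^'] -->
    L ('D_v f x).
  have -> : (fun h : R => h^-1 *: ((L \o f) (h *: v + x) - (L \o f) x)) =
      L \o (fun h : R => h^-1 *: (f (h *: v + x) - f x)).
    apply/funext => h /=; rewrite -[L]/(L' : W -> X) -linearB -linearZ.
    by [].
  by apply: continuous_cvg; [exact: Lcont | exact: fxv].
by split; [apply/cvg_ex; exists (L ('D_v f x)) | exact: cvg_lim cvL].
Qed.

(** The difference quotients of the two sides coincide, so the identity holds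
    at every point, whether or not f is differentiable there. *)
Lemma derive_comp_linear {X : normedModType R} (f : W -> X) (L : V -> W) v :
  linear L -> 'D_v (f \o L) = 'D_(L v) f \o L.
Proof.
move=> Llin; apply/funext => x; rewrite /derive /comp.
by under eq_fun do rewrite Llin.
Qed.

Lemma is_derive_comp_linear {X : normedModType R} (f : W -> X) (L : V -> W)
    (x v : V) (df : X) : linear L ->
  is_derive (L x) (L v) f df -> is_derive x v (f \o L) df.
Proof.
move=> Llin [fxv <-]; split.
  move: fxv; rewrite /derivable /comp.
  by under [X in _ -> cvg (X @ _)]eq_fun do rewrite Llin.
by rewrite [LHS](congr1 (@^~ x) (derive_comp_linear f v Llin)).
Qed.

(** The limit defining the derivative inside A is the restriction of a limit
    that exists for g; the last hypothesis makes the restricted filter proper,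
    without which a limit along it would be meaningless. *)
Lemma derive_in_ext (A O : set V) (f g : V -> W) (v x : V) :
  open O -> O x -> A x -> {in O `&` A, f =1 g} -> derivable g x v ->
  limit_point [set h : R | A (h *: v + x)] 0 ->
  derive_in A f v x = 'D_v g x.
Proof.
move=> Oo Ox Ax fg gxv lim0.
set D := [set h : R | A (h *: v + x)].
have Dproper : ProperFilter (within D 0^').
  apply: Build_ProperFilter_ex => P.
  rewrite /within /= /dnbhs /within /= => /lim0[h [/= h0 Dh]].
  by move/(_ h0 Dh); exists h.
apply: cvg_lim => //.
have cg : h^-1 *: (g (h *: v + x) - g x) @[h --> within D 0^'] --> 'D_v g x.
  exact: cvg_trans (cvg_app _ (@cvg_within _ _ _ _)) gxv.
apply: cvg_trans cg; apply: near_eq_cvg.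
have cO : \forall h \near (0 : R), O (h *: v + x).
  have : h *: v + x @[h --> (0 : R)] --> x.
    rewrite -[X in _ --> X]add0r -(scale0r v).
    by apply: cvgD; [apply: cvgZr_tmp; exact: cvg_id | exact: cvg_cst].
  by apply; exact: open_nbhs_nbhs.
suff : \forall h \near (0 : R), h != 0 -> D h ->
    h^-1 *: (g (h *: v + x) - g x) = h^-1 *: (f (h *: v + x) - f x) by [].
apply: filterS cO => h Oh _ Dh.
by rewrite !fg ?inE//; split.
Qed.

(** Differentiability is a local property: the little-o condition for f with
    its own differential transfers to g, which makes that map the differential
    of g as well. *)
Lemma near_eq_differentiable (f g : V -> W) x :
  (\forall y \near x, f y = g y) -> differentiable f x -> differentiable g x.
Proof.
move=> fg /diff_locallyP[dfcont dfx].
have dgx : g \o shift x = cst (g x) + 'd f x +o_ (0 : V) id.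
  apply/eqaddoP => e e0; move/eqaddoP: dfx => /(_ e e0) dfx.
  have fg0 : \forall h \near (0 : V), f (h + x) = g (h + x).
    have : h + x @[h --> (0 : V)] --> x.
      rewrite -[X in _ --> X]add0r.
      by apply: cvgD; [exact: cvg_id | exact: cvg_cst].
    by move=> hx; exact: hx fg.
  apply: filterS2 fg0 dfx => h.
  by rewrite !fctE /= (nbhs_singleton fg) => ->.
have dgE := diff_unique dfcont dgx.
by apply/diff_locallyP; rewrite dgE.
Qed.

Lemma differentiable_linear (L : V -> W) x : linear L -> continuous L ->
  differentiable L x.
Proof.
move=> Llin Lcont.
pose L' : {linear V -> W} := HB.pack L (GRing.isLinear.Build _ _ _ _ L Llin).
exact: (@linear_differentiable _ _ _ L').
Qed.

End DirectionalDerivative.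

(** * Maps of class C^k on an open set *)

Section Ck_theory.
Context {R : realType} {V W : normedModType R}.
Implicit Types (O : set V) (f g : V -> W).

Lemma Ck_subset k O O' f : O' `<=` O -> Ck k O f -> Ck k O' f.
Proof.
move=> O'O; elim: k f => [f Cf x /O'O/Cf//|k IHk f [df Cf]].
by split=> [x /O'O/df//|v]; exact: IHk (Cf v).
Qed.

Lemma Ck_lower k O f : Ck k.+1 O f -> Ck k O f.
Proof.
elim: k f => [f [df _] x /df/differentiable_continuous//|k IHk f [df Cf]].
by split=> // v; apply: IHk.
Qed.

(** On an open set, maps that agree there have the same germs, hence the same
    derivatives of all orders; the formulas for the derivative of
    a sum, of a product and of L \o f hold only where f and g are
    differentiable, that is, only on O. *)
Lemma eq_Ck k O f g : open O -> {in O, f =1 g} -> Ck k O f -> Ck k O g.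
Proof.
move=> Oo; have near_fg f' g' x : {in O, f' =1 g'} -> O x ->
    \forall y \near x, f' y = g' y.
  move=> fg Ox; apply: filterS (open_nbhs_nbhs (conj Oo Ox)) => y Oy.
  by rewrite fg// inE.
elim: k f g => [|k IHk] f g fg.
  move=> Cf x Ox; have : f @ x --> f x := Cf x Ox.
  rewrite [X in _ --> X]fg ?inE// => cvf.
  by apply: cvg_trans cvf; apply: near_eq_cvg; exact: near_fg.
move=> [df Cf]; split=> [x Ox|v].
  exact: near_eq_differentiable (near_fg _ _ _ fg Ox) (df x Ox).
apply: IHk (Cf v) => x; rewrite inE => Ox.
by apply: near_eq_derive; exact: near_fg.
Qed.

Lemma Ck_cst k O (c : W) : Ck k O (cst c).
Proof.
elim: k c => [c x _|k IHk c]; first exact: cvg_cst.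
split=> [x _|v]; first exact: differentiable_cst.
suff -> : 'D_v (cst c : V -> W) = cst 0 by exact: IHk.
by apply/funext => x; rewrite derive_cst.
Qed.

Lemma Ck_linear k O (L : V -> W) : linear L -> continuous L -> Ck k O L.
Proof.
move=> Llin Lcont; case: k => [x _|k]; first exact: Lcont.
split=> [x _|v]; first exact: differentiable_linear.
suff -> : 'D_v L = cst (L v) by exact: Ck_cst.
apply/funext => x; have idv : is_derive x v (@idfun V) v by exact: is_derive_id.
by have [_ <-] := is_derive_linear_comp Llin Lcont idv.
Qed.

Lemma CkD k O f g : open O -> Ck k O f -> Ck k O g -> Ck k O (f + g).
Proof.
move=> Oo; elim: k f g => [|k IHk] f g Cf Cg.
  by move=> x Ox; apply: continuousD; [exact: Cf|exact: Cg].
have [[df Cdf] [dg Cdg]] := (Cf, Cg).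
split=> [x Ox|v]; first by apply: differentiableD; [exact: df|exact: dg].
apply: (eq_Ck Oo _ (IHk _ _ (Cdf v) (Cdg v))) => x; rewrite inE => Ox.
by rewrite deriveD//; apply: diff_derivable; [exact: df|exact: dg].
Qed.

Lemma Ck_comp_linear {X : normedModType R} k (O : set W) (f : W -> X)
    (L : V -> W) : linear L -> continuous L ->
  Ck k O f -> Ck k (L @^-1` O) (f \o L).
Proof.
move=> Llin Lcont; elim: k f => [f Cf x Ox|k IHk f [df Cf]].
  by apply: continuous_comp; [exact: Lcont|exact: Cf].
split=> [x Ox|v]; last by rewrite derive_comp_linear//; exact: IHk (Cf (L v)).
apply: differentiable_comp; last exact: df.
exact: differentiable_linear.
Qed.

End Ck_theory.

Lemma Ck_linear_comp {R : realType} {V W X : normedModType R} (L : W -> X) k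
    (O : set V) (f : V -> W) :
  open O -> linear L -> continuous L -> Ck k O f -> Ck k O (L \o f).
Proof.
move=> Oo Llin Lcont; elim: k f => [f Cf x Ox|k IHk f [df Cf]].
  by apply: continuous_comp; [exact: Cf|exact: Lcont].
split=> [x Ox|v].
  apply: differentiable_comp; first exact: df.
  exact: differentiable_linear.
apply: (eq_Ck Oo _ (IHk _ (Cf v))) => x; rewrite inE => Ox /=.
have fxv : is_derive x v f ('D_v f x).
  by apply/derivableP/diff_derivable/df.
by have [_ ->] := is_derive_linear_comp Llin Lcont fxv.
Qed.

Lemma CkM {R : realType} {V : normedModType R} k (O : set V) (f g : V -> R) :
  open O -> Ck k O f -> Ck k O g -> Ck k O (f * g).
Proof.
move=> Oo; elim: k f g => [|k IHk] f g Cf Cg.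
  by move=> x Ox; apply: continuousM; [exact: Cf|exact: Cg].
have [[df Cdf] [dg Cdg]] := (Cf, Cg).
split=> [x Ox|v]; first by apply: differentiableM; [exact: df|exact: dg].
apply: (eq_Ck Oo (f := f * 'D_v g + g * 'D_v f)) => [x|].
  rewrite inE => Ox.
  by rewrite deriveM//; apply: diff_derivable; [exact: df|exact: dg].
by apply: CkD => //; [exact: IHk (Ck_lower Cf) (Cdg v)
  | exact: IHk (Ck_lower Cg) (Cdf v)].
Qed.

(** * Smooth maps on an arbitrary set *)

Section Smooth.
Context {R : realType} {V W : normedModType R}.
Implicit Types (A : set V) (f g : V -> W).

Lemma smooth_on_cst A (c : W) : smooth_on A (fun=> c).
Proof.
move=> x _; exists setT, (cst c).
by split=> //; [exact: openT | move=> k; exact: Ck_cst].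
Qed.

Lemma smooth_on_linear A (L : V -> W) :
  linear L -> continuous L -> smooth_on A L.
Proof.
move=> Llin Lcont x _; exists setT, L.
by split=> //; [exact: openT | move=> k; exact: Ck_linear].
Qed.

Lemma smooth_onD A f g : smooth_on A f -> smooth_on A g ->
  smooth_on A (fun x => f x + g x).
Proof.
move=> sf sg x Ax.
have [ O [f' [Oo Ox Cf ff']]] := sf x Ax.
have [ P [g' [Po Px Cg gg']]] := sg x Ax.
exists (O `&` P), (f' + g'); split=> //; first exact: openI.
  by move=> k; apply: CkD; [exact: openI
    | exact: Ck_subset (@subIsetl _ _ _) (Cf k)
    | exact: Ck_subset (@subIsetr _ _ _) (Cg k)].
by move=> y; rewrite inE => -[[Oy Py] Ay]; rewrite ff' ?gg' ?inE.
Qed.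

Lemma smooth_on_comp_linear {X : normedModType R} A (B : set W)
    (f : W -> X) (L : V -> W) : linear L -> continuous L ->
  (forall x, A x -> B (L x)) -> smooth_on B f ->
  smooth_on A (fun x => f (L x)).
Proof.
move=> Llin Lcont AB sf x Ax; have [ O [g [Oo Ox Cg fg]]] := sf _ (AB x Ax).
exists (L @^-1` O), (g \o L); split=> //.
- by apply: open_comp => // y _; exact: Lcont.
- by move=> k; exact: Ck_comp_linear.
move=> y; rewrite inE => -[Oy Ay] /=.
by rewrite fg// inE; split => //; exact: AB.
Qed.

Lemma smooth_on_linear_comp {X : normedModType R} A (f : V -> W) (L : W -> X) :
  linear L -> continuous L -> smooth_on A f -> smooth_on A (fun x => L (f x)).
Proof.
move=> Llin Lcont sf x Ax; have [ O [g [Oo Ox Cg fg]]] := sf x Ax.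
exists O, (L \o g); split=> //; first by move=> k; exact: Ck_linear_comp.
by move=> y yOA /=; rewrite fg.
Qed.

(** Locally the derivative inside A is the derivative of a smooth extension,
    which is itself a smooth extension of it. *)
Lemma smooth_on_derive_in A f (v : V) : smooth_on A f ->
  (forall x, A x -> limit_point [set h : R | A (h *: v + x)] 0) ->
  smooth_on A (derive_in A f v).
Proof.
move=> sf Av x Ax; have [ O [g [Oo Ox Cg fg]]] := sf x Ax.
exists O, ('D_v g); split=> // [k|y]; first by have [_] := Cg k.+1; exact.
rewrite inE => -[Oy Ay]; apply: (derive_in_ext Oo Oy Ay fg _ (Av y Ay)).
by apply: diff_derivable; have [dg _] := Cg 1; exact: dg.
Qed.

End Smooth.

Section SmoothReal.
Context {R : realType} {V : normedModType R}.
Implicit Types (A : set V) (f g h : V -> R).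

Lemma smooth_onM A f g : smooth_on A f -> smooth_on A g ->
  smooth_on A (fun x => f x * g x).
Proof.
move=> sf sg x Ax.
have [ O [f' [Oo Ox Cf ff']]] := sf x Ax.
have [ P [g' [Po Px Cg gg']]] := sg x Ax.
exists (O `&` P), (f' * g'); split=> //; first exact: openI.
  by move=> k; apply: CkM; [exact: openI
    | exact: Ck_subset (@subIsetl _ _ _) (Cf k)
    | exact: Ck_subset (@subIsetr _ _ _) (Cg k)].
by move=> y; rewrite inE => -[[Oy Py] Ay]; rewrite ff' ?gg' ?inE.
Qed.

Lemma smooth_onN A f : smooth_on A f -> smooth_on A (fun x => - f x).
Proof.
move=> sf; under eq_fun do rewrite -mulN1r.
by apply: smooth_onM sf; exact: smooth_on_cst.
Qed.

Lemma smooth_on_coord n A (f : V -> 'rV[R]_n) (i : 'I_n) :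
  smooth_on A f -> smooth_on A (fun x => f x 0 i).
Proof.
apply: (smooth_on_linear_comp (L := fun w : 'rV[R]_n => w 0 i)).
  by move=> a u w; rewrite !mxE.
exact: coord_continuous.
Qed.

(** Presents a vector-valued map as a sum of images of its components under
    linear maps, so that calculus reduces to that of the components. *)
Lemma row3E (a b c : R) : row3 a b c =
  a *: delta_mx 0 0 + b *: delta_mx 0 1 + c *: delta_mx 0 2.
Proof.
apply/rowP => i; rewrite !mxE.
case: i => [[|[|[|//]]] ilt] /=; rewrite !mulr0 !mulr1 ?addr0 ?add0r//.
Qed.

Lemma scalel_linear (w : 'rV[R]_3) : linear (fun a : R => a *: w).
Proof. by move=> a x y; rewrite scalerDl scalerA. Qed.

Lemma smooth_on_row3 A f g h :
  smooth_on A f -> smooth_on A g -> smooth_on A h ->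
  smooth_on A (fun x => row3 (f x) (g x) (h x)).
Proof.
move=> sf sg sh; under eq_fun do rewrite row3E.
have S w (k : V -> R) : smooth_on A k ->
    smooth_on A (fun x => k x *: w : 'rV[R]_3).
  apply: (smooth_on_linear_comp (L := fun a : R => a *: w)).
    exact: scalel_linear.
  exact: scalel_continuous.
by apply: smooth_onD; [apply: smooth_onD|]; exact: S.
Qed.

Lemma is_derive_row3 (x v : V) f g h df dg dh :
  is_derive x v f df -> is_derive x v g dg -> is_derive x v h dh ->
  is_derive x v (fun y => row3 (f y) (g y) (h y)) (row3 df dg dh).
Proof.
move=> Df Dg Dh; under eq_fun do rewrite row3E.
have D w (k : V -> R) dk : is_derive x v k dk ->
    is_derive x v (fun y => k y *: w : 'rV[R]_3) (dk *: w).
  move=> Dk; apply: (is_derive_linear_comp (L := fun a : R => a *: w)) => //.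
    exact: scalel_linear.
  exact: scalel_continuous.
by rewrite row3E; apply: is_deriveD.
Qed.

End SmoothReal.

(** * Hyperbolic functions *)

Section Hyperbolic.
Context {R : realType}.

Lemma smooth_on_expR : smooth_on setT (@expR R).
Proof.
move=> x _; exists setT, (fun t => 1 * expR t).
split=> //; [exact: openT | | by move=> y _; rewrite mul1r].
(* Derivatives of exp in the direction v carry a factor v: the induction runs
   over all multiples of exp. *)
move=> k; elim: k (1 : R) => [|k IHk] c.
  by move=> y _; apply: continuousM; [exact: cvg_cst | exact: continuous_expR].
have Dexp y : differentiable (fun t : R => c * expR t) y.
  apply: differentiableM => //; apply/derivable1_diffP.
  exact: derivable_expR.
split=> [y _ //|v].
suff -> : 'D_v (fun t : R => c * expR t) = (fun t => (c * v) * expR t) by [].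
apply/funext => y; have -> : v = v *: (1 : R) by rewrite /GRing.scale /= mulr1.
rewrite deriveE// linearZ -deriveE//.
have [_ ->] : is_derive y 1 (fun t : R => c * expR t) (c * expR y).
  by apply: is_derive_eq; rewrite /GRing.scale /=; ring.
suff E (w : R) : w * (c * expR y) = c * (w * 1) * expR y by exact: E.
by ring.
Qed.

Lemma smooth_on_cosh : smooth_on setT (@cosh R).
Proof.
apply: smooth_onM; last exact: smooth_on_cst.
apply: smooth_onD; first exact: smooth_on_expR.
apply: (smooth_on_comp_linear (L := -%R) (B := setT)) => //.
- by move=> a x y; rewrite opprD scalerN.
- exact: opp_continuous.
- exact: smooth_on_expR.
Qed.

Lemma smooth_on_sinh : smooth_on setT (@sinh R).
Proof.
apply: smooth_onM; last exact: smooth_on_cst.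
apply: smooth_onD; first exact: smooth_on_expR.
apply: smooth_onN.
apply: (smooth_on_comp_linear (L := -%R) (B := setT)) => //.
- by move=> a x y; rewrite opprD scalerN.
- exact: opp_continuous.
- exact: smooth_on_expR.
Qed.

Lemma is_derive_cosh (t : R) : is_derive t 1 (@cosh R) (sinh t).
Proof.
rewrite /cosh /sinh.
apply: is_derive_eq.
by rewrite /= /GRing.scale /=; ring.
Qed.

Lemma is_derive_sinh (t : R) : is_derive t 1 (@sinh R) (cosh t).
Proof.
rewrite /cosh /sinh.
apply: is_derive_eq.
by rewrite /= /GRing.scale /=; ring.
Qed.

Lemma cosh2_sinh2 (t : R) : cosh t ^+ 2 - sinh t ^+ 2 = 1.
Proof.
have e : expR t * expR (- t) = 1 by rewrite -expRD subrr expR0.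
rewrite /cosh /sinh -[RHS]e.
by field.
Qed.

End Hyperbolic.

(** * Derivatives on I x R of maps built from one-variable maps *)

(** An interval which is not a point contains a whole segment from u to some
    other point c, along which u is approached from one side. *)
Lemma interval_limit_point {R : realType} (I : set R) (u : R) :
  is_interval I -> I° !=set0 -> I u ->
  limit_point [set h : R | I (h *: 1 + u)] 0.
Proof.
move=> Iitv [c0 Ic0] Iu.
have [c [Ic cu]] : exists c, I c /\ c != u.
  have [c0u|] := eqVneq c0 u; last first.
    by exists c0; split=> //; exact: interior_subset.
  have near_c : \forall c \near c0^'+, I c /\ c != u.
    near=> c; split; first by near: c; apply: cvg_within; exact: Ic0.
    by rewrite -c0u gt_eqF//; near: c; exact: nbhs_right_gt.
  by apply: filter_ex near_c; exact: at_right_proper_filter.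
move=> U U0.
have : \forall t \near (0 : R)^'+, [/\ U (t * (c - u)), 0 < t & t < 1].
  have tU : \forall t \near (0 : R), U (t * (c - u)).
    have : t * (c - u) @[t --> (0 : R)] --> 0.
      rewrite -[X in _ --> X](mul0r (c - u)).
      by apply: cvgM; [exact: cvg_id | exact: cvg_cst].
    by move=> /(_ _ U0).
  have tUr : \forall t \near (0 : R)^'+, U (t * (c - u)).
    by apply: cvg_within; exact: tU.
  by apply: filterS3 tUr (nbhs_right_gt 0) (nbhs_right_lt ltr01) => t.
move=> /filter_ex[t [Ut t0 t1]]; exists (t * (c - u)); split=> //=.
  by rewrite mulf_neq0 ?subr_eq0 ?(gt_eqF t0).
have -> : t * (c - u) *: (1 : R) + u = (1 - t) * u + t * c.
  by rewrite /GRing.scale /=; ring.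
have [uc|cu'] := leP u c.
  by apply: (Iitv u c) => //; apply/andP; split; nra.
by apply: (Iitv c u) => //; apply/andP; split; nra.
Unshelve. all: by end_near.
Qed.

Section Strip.
Context {R : realType} {W : normedModType R}.

Lemma smooth_on_fst (I : set R) (f : R -> W) :
  smooth_on I f -> smooth_on (I `*` setT) (fun p : R * R => f p.1).
Proof.
apply: (smooth_on_comp_linear (L := @fst R R)) => //; last by move=> p [].
by move=> p; exact: cvg_fst.
Qed.

Lemma smooth_on_snd (I : set R) (f : R -> W) :
  smooth_on setT f -> smooth_on (I `*` setT) (fun p : R * R => f p.2).
Proof.
apply: (smooth_on_comp_linear (L := @snd R R)) => //.
by move=> p; exact: cvg_snd.
Qed.

Lemma is_derive_fst (f : R -> W) (p v : R * R) df :
  is_derive p.1 v.1 f df -> is_derive p v (fun q => f q.1) df.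
Proof. exact: (is_derive_comp_linear (L := @fst R R)). Qed.

Lemma is_derive_snd (f : R -> W) (p v : R * R) df :
  is_derive p.2 v.2 f df -> is_derive p v (fun q => f q.2) df.
Proof. exact: (is_derive_comp_linear (L := @snd R R)). Qed.

End Strip.

(** * The helicoidal surface and its lightcone frame *)

Section Helicoid.
Context {R : realType}.
Implicit Types (g : R -> 'rV[R]_2) (lambda : R).

Lemma is_derive_coord n (g : R -> 'rV[R]_n) (i : 'I_n) (u v : R) dg :
  is_derive u v g dg -> is_derive u v (fun t => g t 0 i) (dg 0 i).
Proof.
apply: (is_derive_linear_comp (L := fun w : 'rV[R]_n => w 0 i)).
  by move=> a x y; rewrite !mxE.
exact: coord_continuous.
Qed.

Lemma is_derive_helicoidal2_u g lambda (p : R * R) dg : is_derive p.1 1 g dg ->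
  is_derive p (1, 0) (helicoidal2 g lambda)
    (row3 (dg 0 0 * cosh p.2) (dg 0 0 * sinh p.2) (dg 0 1)).
Proof.
move=> Dg.
have Dx i : is_derive p (1, 0) (fun q : R * R => g q.1 0 i) (dg 0 i).
  by apply: (@is_derive_fst R R (fun t => g t 0 i)); exact: is_derive_coord.
have Dsnd (f : R -> R) : is_derive p (1, 0) (fun q : R * R => f q.2) 0.
  by apply: is_derive_snd; exact: is_derive0.
have Dch := Dsnd (@cosh R); have Dsh := Dsnd (@sinh R).
have Did := Dsnd idfun.
apply: is_derive_row3.
all: by apply: is_derive_eq; rewrite /GRing.scale /=; ring.
Qed.

Lemma is_derive_helicoidal2_v g lambda (p : R * R) :
  is_derive p (0, 1) (helicoidal2 g lambda)
    (row3 (g p.1 0 0 * sinh p.2) (g p.1 0 0 * cosh p.2) lambda).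
Proof.
have Dx i : is_derive p (0, 1) (fun q : R * R => g q.1 0 i) 0.
  by apply: (@is_derive_fst R R (fun t => g t 0 i)); exact: is_derive0.
have Dch : is_derive p (0, 1) (fun q : R * R => cosh q.2) (sinh p.2).
  by apply: is_derive_snd; exact: is_derive_cosh.
have Dsh : is_derive p (0, 1) (fun q : R * R => sinh q.2) (cosh p.2).
  by apply: is_derive_snd; exact: is_derive_sinh.
have Did : is_derive p (0, 1) (fun q : R * R => idfun q.2) 1.
  by apply: is_derive_snd; exact: is_derive_id.
apply: is_derive_row3.
all: by apply: is_derive_eq; rewrite /GRing.scale /=; ring.
Qed.

Lemma smooth_on_helicoidal2 (I : set R) g lambda :
  smooth_on I g -> smooth_on (I `*` setT) (helicoidal2 g lambda).
Proof.
move=> sg; have sx i := smooth_on_fst (smooth_on_coord i sg).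
apply: smooth_on_row3.
- by apply: smooth_onM => //; apply: smooth_on_snd; exact: smooth_on_cosh.
- by apply: smooth_onM => //; apply: smooth_on_snd; exact: smooth_on_sinh.
- apply: smooth_onD => //; apply: smooth_onM; first exact: smooth_on_cst.
  by apply: smooth_on_linear => // q; exact: cvg_snd.
Qed.

(** Near p the surface extends to the helicoidal surface of a smooth extension
    f of g, whose partial derivatives are ordinary ones. *)
Lemma partials_helicoidal2 g lambda (I : set R) (p : R * R) :
  is_interval I -> I° !=set0 -> smooth_on I g -> I p.1 ->
  let dg := derive_in I g 1 p.1 in
  partial_u (I `*` setT) (helicoidal2 g lambda) p =
    row3 (dg 0 0 * cosh p.2) (dg 0 0 * sinh p.2) (dg 0 1) /\
  partial_v (I `*` setT) (helicoidal2 g lambda) p =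
    row3 (g p.1 0 0 * sinh p.2) (g p.1 0 0 * cosh p.2) lambda.
Proof.
move=> Iitv I0 sg Ip dg.
have [ O [f [Oo Op Cf gf]]] := sg _ Ip.
have lim0 := interval_limit_point Iitv I0 Ip.
have Df : is_derive p.1 1 f dg.
  have [df _] := Cf 1; have dfp := diff_derivable (df _ Op).
  by split=> //; rewrite /dg (derive_in_ext Oo Op Ip gf _ lim0).
have Du := is_derive_helicoidal2_u lambda Df.
have Dv := is_derive_helicoidal2_v f lambda p.
have OTo : open (O `*` [set: R]).
  rewrite (_ : _ `*` _ = fst @^-1` O); last first.
    by apply/seteqP; split=> [q []|q Oq].
  by apply: open_comp => // q _; exact: cvg_fst.
have ext : {in (O `*` setT) `&` (I `*` setT),
    helicoidal2 g lambda =1 helicoidal2 f lambda}.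
  move=> q; rewrite inE => -[[/= Oq _] [Iq _]].
  by rewrite /helicoidal2 gf// inE.
have limu : limit_point [set h : R | (I `*` setT) (h *: (1, 0) + p)] 0.
  by move=> U /lim0[h [h0 Ih Uh]]; exists h.
(* Moving along v never leaves I x R, so the witnesses for I serve here too. *)
have limv : limit_point [set h : R | (I `*` setT) (h *: (0, 1) + p)] 0.
  move=> U /lim0[h [h0 _ Uh]]; exists h; split=> //; split=> //=.
  by rewrite scaler0 add0r.
have [OTp ITp] : (O `*` setT) p /\ (I `*` setT) p by [].
split.
  have [du <-] := Du; exact: (derive_in_ext OTo OTp ITp ext du limu).
rewrite gf ?inE//; have [dv <-] := Dv.
exact: (derive_in_ext OTo OTp ITp ext dv limv).
Qed.

Definition ellp (nu : R -> 'rV[R]_2) (p : R * R) : 'rV[R]_3 :=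
  row3 (nu p.1 0 0 * cosh p.2 + sinh p.2)
       (nu p.1 0 0 * sinh p.2 + cosh p.2) (nu p.1 0 1).
Definition ellm (nu : R -> 'rV[R]_2) (p : R * R) : 'rV[R]_3 :=
  row3 (nu p.1 0 0 * cosh p.2 - sinh p.2)
       (nu p.1 0 0 * sinh p.2 - cosh p.2) (nu p.1 0 1).

(** With n and t the half sum and half difference of the two vectors,
    <n, n> = -1, <t, t> = 1 and <n, t> = 0.  A product equal to -2 already
    forces both vectors to be non-zero. *)
Lemma Delta4_ell (nu : R -> 'rV[R]_2) p :
  nu p.1 0 0 ^+ 2 - nu p.1 0 1 ^+ 2 = 1 ->
  Delta4 (ellp nu p, ellm nu p).
Proof.
move=> /eqP; rewrite subr_eq => /eqP nu1.
have /eqP := cosh2_sinh2 p.2; rewrite subr_eq => /eqP ch1.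
have pm : pinner3 (ellp nu p) (ellm nu p) = -2.
  by rewrite /pinner3 !mxE /=; ring: nu1 ch1.
have n0 v w : pinner3 v w = - 2 -> v != 0 /\ w != 0 :> 'rV[R]_3.
  move=> vw; split; apply/negP => /eqP v0; move: vw;
   rewrite v0 /pinner3 !mxE; lra.
have [p0 m0] := n0 _ _ pm.
by split=> //; split=> //=; rewrite /pinner3 !mxE /=; ring: nu1 ch1.
Qed.

End Helicoid.

Unset Implicit Arguments.

Theorem proposition3p7 (R : realType) (I : set R)
  (gamma nu : R -> 'rV[R]_2) (delta lambda : R)
  (I_interval : is_interval I) (I_nondegenerate : I° !=set0)
  (gamma_nu_Legendre : nonlightlike_Legendre_curve I gamma nu)
  (delta_def : forall u, I u -> delta = nu u 0 0 ^+ 2 - nu u 0 1 ^+ 2)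
  (lambda_neq0 : lambda != 0)
  (delta1 : delta = 1) :
  lightcone_framed_base_surface (I `*` setT) (helicoidal2 gamma lambda).
Proof.
have [sg sn _ Leg] := gamma_nu_Legendre.
split; first exact: smooth_on_helicoidal2.
have nu1 u : I u -> nu u 0 0 ^+ 2 - nu u 0 1 ^+ 2 = 1.
  by move=> Iu; rewrite -delta_def.
set dg := derive_in I gamma 1.
have sdg : smooth_on I dg.
  by apply: smooth_on_derive_in => // u Iu; exact: interval_limit_point.
(* The factor with gamma' = beta (b, a), in a form that is smooth without
   dividing by anything. *)
pose beta u := nu u 0 0 * dg u 0 1 - nu u 0 1 * dg u 0 0.
have sbeta : smooth_on I beta.
  by apply: smooth_onD; [|apply: smooth_onN]; apply: smooth_onM;
    exact: smooth_on_coord.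
have sa i := smooth_on_fst (smooth_on_coord i sn).
have sx i := smooth_on_fst (smooth_on_coord i sg).
have sb := smooth_on_fst sbeta.
have sch := smooth_on_snd (I := I) (@smooth_on_cosh R).
have ssh := smooth_on_snd (I := I) (@smooth_on_sinh R).
exists (ellp nu), (ellm nu),
  (fun p => beta p.1 * (gamma p.1 0 0 + - (lambda * nu p.1 0 1)) * 2^-1),
  (fun p => beta p.1 * (gamma p.1 0 0 + lambda * nu p.1 0 1) * 2^-1).
split.
- by split; apply: smooth_on_row3 => //; apply: smooth_onD;
    by [exact: smooth_onM | exact: smooth_onN |].
- by move=> p [Ip _]; apply: Delta4_ell; exact: nu1.
- have slb : smooth_on (I `*` setT) (fun p : R * R => lambda * nu p.1 0 1).
    by apply: smooth_onM => //; exact: smooth_on_cst.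
  by split; apply: smooth_onM; try exact: smooth_on_cst;
    apply: smooth_onM => //; apply: smooth_onD => //; exact: smooth_onN.
move=> p [Ip _]; have [-> ->] :=
  partials_helicoidal2 lambda I_interval I_nondegenerate sg Ip.
rewrite -/dg.
have := Leg _ Ip; rewrite -/dg /pinner2 addrC => /subr0_eq leg.
have /eqP := nu1 _ Ip; rewrite subr_eq => /eqP nup.
have dg0 : dg p.1 0 0 = beta p.1 * nu p.1 0 1 by rewrite /beta; ring: leg nup.
have dg1 : dg p.1 0 1 = beta p.1 * nu p.1 0 0 by rewrite /beta; ring: leg nup.
rewrite dg0 dg1; move: (beta p.1) => b.
have /eqP := cosh2_sinh2 p.2; rewrite subr_eq => /eqP ch1.
apply/rowP => -[[|[|[|//]]] ilt]; rewrite !mxE /=; [by field|by field|].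
by field: ch1.
Qed.
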